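(* Let $F:P\to P'$ be a discrete analytic function between circle packings $P,P'$ sharing the same complex. Let $\{C_v,C_w\,|\,C_a,C_b\}$ be a patch of $P$ with interior edge $e=\{C_v,C_w\}$, whose tangency point is finite, and let $\{C'_v,C'_w\,|\,C'_a,C'_b\}$ be the corresponding patch of $P'$ with edge $e'=\{C'_v,C'_w\}$. Let $s$ and $s'$ be the intrinsic schwarzians of $e$ and $e'$, respectively, and let $m(z)=\frac{az+b}{cz+d}$, $ad-bc=1$, be the Möbius transformation taking the base face $(C^\Delta_v,C^\Delta_w,C^\Delta_a)$ to $(C_v,C_w,C_a)$. Then $$s'=s+\Sigma_F(e)\cdot m'(1)=s+\frac{\Sigma_F(e)}{(c+d)^2}.$$
   Context: **Circles.** Circles lie on the Riemann sphere $\mathbb P=\mathbb C\cup\{\infty\}$; each circle comes with a chosen interior, an open disc. Two circles are (externally) tangent if they meet in exactly one point and their interiors are disjoint. For any two ordered triples of mutually tangent circles there is a unique Möbius transformation taking the first triple to the second in order. **Circle packings and maps.** A circle packing $P$ for a complex $K$ (a triangulation of a surface) assigns to each vertex $v$ of $K$ a circle $C_v$ so that $C_v$ and $C_w$ are tangent whenever $\langle v,w\rangle$ is an edge of $K$. If $P,P'$ are circle packings for the same $K$, the map $F:P\to P'$ identifying corresponding circles, $C_v\mapsto C'_v$, is called a discrete analytic function. A patch $\{C_v,C_w\,|\,C_a,C_b\}$ of $P$ comes from two faces $f=\{v,w,a\}$, $g=\{w,v,b\}$ of $K$ sharing an edge $e=\{v,w\}$, which is positively oriented with respect to $f$. (Only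 the two triples of mutually tangent circles $\{C_v,C_w,C_a\}$ and $\{C_v,C_w,C_b\}$ and their images matter here.) **Discrete Schwarzian derivative.** Let $m_f$ be the Möbius transformation taking $(C_v,C_w,C_a)$ to $(C'_v,C'_w,C'_a)$ and $m_g$ the one taking $(C_v,C_w,C_b)$ to $(C'_v,C'_w,C'_b)$. Let $t$ be the (finite) tangency point of $C_v$ and $C_w$. Then $m_g^{-1}\circ m_f$ is the identity or parabolic with fixed point $t$, and is represented by a matrix $$I+\sigma\begin{bmatrix}t&-t^2\\1&-t\end{bmatrix}$$ for a unique $\sigma\in\mathbb C$; one defines $\Sigma_F(e)=\sigma$. **Intrinsic schwarzian.** The base patch consists of the circles of radius $\sqrt3$ with $C^\Delta_v$ centered at $1-\sqrt3\,i$, $C^\Delta_w$ at $1+\sqrt3\,i$, $C^\Delta_a$ at $-2$, $C^\Delta_b$ at $4$ (so the tangency point of $C^\Delta_v$ and $C^\Delta_w$ is $1$). For a patch $\{C_v,C_w\,|\,C_a,C_b\}$, let $\mu_f$ be the Möbius transformation taking $(C^\Delta_v,C^\Delta_w,C^\Delta_a)$ to $(C_v,C_w,C_a)$ and $\mu_g$ the one taking $(C^\Delta_v,C^\Delta_w,C^\Delta_b)$ to $(C_v,C_w,C_b)$. Then $\mu_g^{-1}\circ\mu_f$ is represented by a matrix $\begin{bmatrix}1+s&-s\\ s&1-s\end{bmatrix}$ for a unique real $s$, the intrinsic schwarzian of the patch (of its edge). *)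

(* Defs.v *)
From HB Require Import structures.
From Stdlib Require Import Relation_Operators.
From mathcomp Require Import all_boot all_order all_algebra.
From mathcomp Require Import complex.
From mathcomp Require Import all_classical all_reals all_analysis.

Set Implicit Arguments.
Unset Strict Implicit.
Unset Printing Implicit Defensive.

Import Order.TTheory GRing.Theory Num.Theory.
Import numFieldNormedType.Exports.

Local Open Scope classical_set_scope.
Local Open Scope ring_scope.
Local Open Scope complex_scope.

(* The field R[i], ascribed as a numFieldType: it then carries the canonical
   normed topology, so that derive1 on it is the complex derivative. *)
Definition Cx (R : realType) : numFieldType := R[i].

(* The Riemann sphere; None is the point at infinity. *)
Definition sphere (R : realType) : Type := option (Cx R).

Definition mx22 (K : Type) (a b c d : K) : 'M[K]_2 :=
  \matrix_(i < 2, j < 2)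
    (if i == ord0 then if j == ord0 then a else b
     else if j == ord0 then c else d).

(* The action z |-> (A00 z + A01) / (A10 z + A11) on the sphere; it is a
   Moebius transformation when A is invertible. *)
Definition mobius (R : realType) (A : 'M[Cx R]_2) (x : sphere R) : sphere R :=
  match x with
  | Some z =>
      if A 1 0 * z + A 1 1 == 0 then None
      else Some ((A 0 0 * z + A 0 1) / (A 1 0 * z + A 1 1))
  | None => if A 1 0 == 0 then None else Some (A 0 0 / A 1 0)
  end.

Definition represented_by (R : realType) (m : sphere R -> sphere R)
    (A : 'M[Cx R]_2) : Prop :=
  A \in unitmx /\ m = mobius A.

Definition is_mobius (R : realType) (m : sphere R -> sphere R) : Prop :=
  exists A : 'M[Cx R]_2, represented_by m A.

(* The map m_g^{-1} \o m_f is represented by the matrix A. *)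
Definition quotient_represented_by (R : realType)
    (mg mf : sphere R -> sphere R) (A : 'M[Cx R]_2) : Prop :=
  exists mg_inv : sphere R -> sphere R,
    [/\ cancel mg mg_inv, cancel mg_inv mg & represented_by (mg_inv \o mf) A].

(* B is a circle of the sphere (a Euclidean circle, or a line together with
   infinity) and D is one of the two open discs that it bounds. Replacing u by
   - u exchanges the two sides of a line. *)
Definition bounds_disc (R : realType) (B D : set (sphere R)) : Prop :=
  (exists (p : Cx R) (r : R),
     [/\ 0 < r,
         B = Some @` [set z | `|z - p| = r%:C] &
         D = Some @` [set z | `|z - p| < r%:C] \/
         D = ~` (Some @` [set z | `|z - p| <= r%:C])]) \/
  (exists p u : Cx R,
     [/\ u != 0,
         B = None |` Some @` [set z | complex.Im ((z - p) / u) = 0] &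
         D = Some @` [set z | 0 < complex.Im ((z - p) / u)]]).

(* A circle with a chosen interior [disc]. *)
Record circle (R : realType) : Type := Circle {
  points : set (sphere R);
  disc : set (sphere R);
  circleP : bounds_disc points disc
}.

Definition tangent_at (R : realType) (C D : circle R) (x : sphere R) : Prop :=
  points C `&` points D = [set x] /\ disc C `&` disc D = set0.

Definition tangent (R : realType) (C D : circle R) : Prop :=
  exists x, tangent_at C D x.

Definition maps_circle (R : realType) (m : sphere R -> sphere R)
    (C D : circle R) : Prop :=
  m @` points C = points D /\ m @` disc C = disc D.

Definition triple (R : realType) : Type := (circle R * circle R * circle R)%type.

Definition maps_triple (R : realType) (m : sphere R -> sphere R)
    (T U : triple R) : Prop :=
  [/\ is_mobius m, maps_circle m T.1.1 U.1.1, maps_circle m T.1.2 U.1.2 &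
      maps_circle m T.2 U.2].

(* A triangulation of an oriented surface, possibly with boundary and not
   necessarily connected or compact, as an abstract simplicial complex given by
   its positively oriented faces: [face v w a] says that {v, w, a} is a face
   whose orientation is the cyclic order v, w, a, so that the edge {v, w}
   traversed from v to w is positively oriented with respect to it. By
   [face_uniq] each edge lies in at most one face on each side, and the link of
   every vertex, being finite and connected, is a path or a cycle. *)
Record surface_complex : Type := SurfaceComplex {
  vertex : Type;
  face : vertex -> vertex -> vertex -> Prop;
  face_rot : forall v w a, face v w a -> face w a v;
  face_neq : forall v w a, face v w a -> v <> w;
  face_oriented : forall v w a, face v w a -> ~ face w v a;
  face_uniq : forall v w a b, face v w a -> face v w b -> a = b;
  vertex_in_face : forall v, exists w a, face v w a;
  link_finite : forall v,
    finite_set [set w | exists a, face v w a \/ face w v a];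
  link_connected : forall v w w',
    (exists a, face v w a \/ face w v a) ->
    (exists a, face v w' a \/ face w' v a) ->
    clos_refl_sym_trans vertex (face v) w w'
}.

Definition edge (K : surface_complex) (v w : vertex K) : Prop :=
  exists a, face v w a \/ face w v a.

Record packing (R : realType) (K : surface_complex) : Type := Packing {
  circ :> vertex K -> circle R;
  packing_tangent : forall v w : vertex K, edge v w -> tangent (circ v) (circ w)
}.

(* The map C_v |-> C'_v from P = source to P' = target. Circles are indexed by
   the vertices of K (distinct vertices may carry the same circle), so this map
   is determined by the two packings. *)
Record discrete_analytic (R : realType) (K : surface_complex) : Type :=
  DiscreteAnalytic { source : packing R K; target : packing R K }.

(* An interior edge {v, w} with its two faces f = {v, w, a}, g = {w, v, b}. *)
Record edge_patch (K : surface_complex) : Type := EdgePatch {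
  pv : vertex K;
  pw : vertex K;
  pa : vertex K;
  pb : vertex K;
  patch_f : face pv pw pa;
  patch_g : face pw pv pb
}.

Definition triple_f (R : realType) (K : surface_complex) (P : packing R K)
    (e : edge_patch K) : triple R := (P (pv e), P (pw e), P (pa e)).

Definition triple_g (R : realType) (K : surface_complex) (P : packing R K)
    (e : edge_patch K) : triple R := (P (pv e), P (pw e), P (pb e)).

(* "sigma = Sigma_F(e)"; t is the finite tangency point of C_v and C_w. *)
Definition is_discrete_schwarzian (R : realType) (K : surface_complex)
    (F : discrete_analytic R K) (e : edge_patch K) (sigma : Cx R) : Prop :=
  exists (t : Cx R) (mf mg : sphere R -> sphere R),
    [/\ tangent_at (source F (pv e)) (source F (pw e)) (Some t),
        maps_triple mf (triple_f (source F) e) (triple_f (target F) e),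
        maps_triple mg (triple_g (source F) e) (triple_g (target F) e) &
        quotient_represented_by mg mf
          (1%:M + sigma *: mx22 t (- t ^+ 2) 1 (- t))].

Lemma bounds_disc_euclid (R : realType) (p : Cx R) (r : R) : 0 < r ->
  bounds_disc (Some @` [set z : Cx R | `|z - p| = r%:C])
              (Some @` [set z : Cx R | `|z - p| < r%:C]).
Proof. by move=> r0; left; exists p, r; split=> //; left. Qed.

Lemma sqrt3_gt0 (R : realType) : 0 < Num.sqrt (3 : R).
Proof. by rewrite sqrtr_gt0 ltr0n. Qed.

Definition base_circle (R : realType) (p : Cx R) : circle R :=
  Circle (bounds_disc_euclid p (sqrt3_gt0 R)).

Definition base_v (R : realType) : circle R :=
  base_circle (1 -i* Num.sqrt 3 : R[i]).
Definition base_w (R : realType) : circle R :=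
  base_circle (1 +i* Num.sqrt 3 : R[i]).
Definition base_a (R : realType) : circle R := base_circle (- 2 : Cx R).
Definition base_b (R : realType) : circle R := base_circle (4 : Cx R).

Definition base_f (R : realType) : triple R := (base_v R, base_w R, base_a R).
Definition base_g (R : realType) : triple R := (base_v R, base_w R, base_b R).

Definition is_intrinsic_schwarzian (R : realType) (K : surface_complex)
    (P : packing R K) (e : edge_patch K) (s : R) : Prop :=
  exists muf mug : sphere R -> sphere R,
    [/\ maps_triple muf (base_f R) (triple_f P e),
        maps_triple mug (base_g R) (triple_g P e) &
        quotient_represented_by mug muf
          (mx22 (1 + s%:C : Cx R) (- s%:C) s%:C (1 - s%:C))].

(* Main.v *)
Require Import Defs.
From mathcomp Require Import all_boot all_order all_algebra.
From mathcomp Require Import complex.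
From mathcomp Require Import ring.
From mathcomp Require Import all_classical all_reals all_analysis.

Set Implicit Arguments.
Unset Strict Implicit.
Unset Printing Implicit Defensive.

Import Order.TTheory GRing.Theory Num.Theory.
Import numFieldNormedType.Exports.

Local Open Scope ring_scope.
Local Open Scope complex_scope.

(* A Moebius map carrying a base triple to a given triple is determined by the
   images of the three tangency points, hence unique. So, with S and S' the
   parabolic maps of parameters s and s', T the one of parameter sigma fixing t,
   and m = mu_f = mu_g S, m_f = m_g T, one has mu_f' = m_f m, mu_g' = m_g mu_g
   and mu_f' = mu_g' S'; cancelling m_g gives
     mu_g S' = T m = m (m^-1 T m) = mu_g S (m^-1 T m).
   As m maps 1 to t, the conjugate m^-1 T m is parabolic with fixed point 1 and
   parameter sigma / (c + d)^2, and parameters add under composition. *)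

(** * Two-by-two matrices through their four entries *)

Lemma det_mx2 (K : comNzRingType) (A : 'M[K]_2) :
  \det A = A 0 0 * A 1 1 - A 0 1 * A 1 0.
Proof.
rewrite (expand_det_row _ 0) !big_ord_recl big_ord0 addr0 /cofactor !det_mx11.
have -> : lift ord0 ord0 = 1 :> 'I_2 by apply/val_inj.
rewrite !mxE /= expr0 expr1 mul1r mulN1r mulrN.
congr (_ * A _ _ - _ * A _ _); exact/val_inj.
Qed.

Lemma mulmx2E (K : comNzRingType) (A B : 'M[K]_2) i j :
  (A *m B) i j = A i 0 * B 0 j + A i 1 * B 1 j.
Proof.
rewrite mxE !big_ord_recl big_ord0 addr0.
by have -> : lift ord0 ord0 = 1 :> 'I_2 by apply/val_inj.
Qed.

Lemma mx22P (K : comNzRingType) (A B : 'M[K]_2) :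
  A 0 0 = B 0 0 -> A 0 1 = B 0 1 -> A 1 0 = B 1 0 -> A 1 1 = B 1 1 -> A = B.
Proof.
move=> e00 e01 e10 e11; apply/matrixP => i j.
have I2 (k : 'I_2) : k = 0 \/ k = 1.
  by case: k => -[|[|//]] ?; [left|right]; exact/val_inj.
by case: (I2 i) => ->; case: (I2 j) => ->.
Qed.

(** * Moebius maps in homogeneous coordinates; rigidity on three points *)

Section Mobius.
Variable R : realType.
Implicit Types (A B : 'M[Cx R]_2) (m : sphere R -> sphere R).

(* The point [x : y] of the projective line; [0 : 0] is the junk value None. *)
Definition proj (x y : Cx R) : sphere R := if y == 0 then None else Some (x / y).

Lemma projZ (k x y : Cx R) : k != 0 -> proj (k * x) (k * y) = proj x y.
Proof.
move=> k0; rewrite /proj mulf_eq0 (negPf k0) /=.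
by case: eqVneq => // y0; rewrite -mulf_div divff// mul1r.
Qed.

(** In homogeneous coordinates the action is linear, so poles and infinity need no separate
    treatment in compositions. *)
Lemma mobius_proj A (x y : Cx R) : (x != 0) || (y != 0) ->
  mobius A (proj x y) = proj (A 0 0 * x + A 0 1 * y) (A 1 0 * x + A 1 1 * y).
Proof.
rewrite {1}/proj; case: (eqVneq y 0) => [->|y0 _] /=.
  rewrite orbF => x0; rewrite !mulr0 !addr0 ![_ * x]mulrC projZ//.
rewrite -[RHS](@projZ y^-1) ?invr_neq0// /proj.
have e (u v : Cx R) : u * (x / y) + v = y^-1 * (u * x + v * y) by field.
by rewrite !e.
Qed.

Lemma mobius_comp A B : B \in unitmx ->
  mobius (A *m B) = mobius A \o mobius B.
Proof.
rewrite unitmxE det_mx2 unitfE => Bu; apply/funext => p /=.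
have [x [y [xy ->]]] : exists x y, (x != 0) || (y != 0) /\ p = proj x y.
  case: p => [z|]; last by exists 1, 0; rewrite oner_eq0 /proj eqxx.
  by exists z, 1; rewrite oner_eq0 orbT /proj oner_eq0 divr1.
rewrite !mobius_proj//; first by rewrite !mulmx2E; congr (proj _ _); ring.
(* [B] cannot send [[x : y]] to [[0 : 0]]: applying the adjugate of [B] would give [\det B * x = 0]
   and [\det B * y = 0]. *)
apply: contraT; rewrite negb_or !negbK => /andP[/eqP e1 /eqP e2].
move: xy; have := mulf_neq0 Bu; case: (eqVneq x 0) => [x0|xn0] h.
  move=> /= y0; have /eqP := h y y0.
  case; rewrite -[RHS](subrr (0 : Cx R)).
  transitivity (B 0 0 * (B 1 0 * x + B 1 1 * y)
    - B 1 0 * (B 0 0 * x + B 0 1 * y)); first by ring.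
  by rewrite e1 e2 !mulr0.
move=> _; have /eqP := h x xn0; case.
transitivity (B 1 1 * (B 0 0 * x + B 0 1 * y)
    - B 0 1 * (B 1 0 * x + B 1 1 * y)); first by ring.
by rewrite e1 e2 !mulr0 subrr.
Qed.

Lemma mobius_scalar (k : Cx R) : k != 0 -> mobius k%:M = id.
Proof.
move=> k0; apply/funext => -[z|] /=; rewrite !mxE /= ?mulr0n ?mulr1n ?eqxx//.
by rewrite mul0r add0r addr0 (negPf k0) mulrAC divff// mul1r.
Qed.

Lemma mobius_bij A : A \in unitmx ->
  cancel (mobius A) (mobius (invmx A)) /\ cancel (mobius (invmx A)) (mobius A).
Proof.
move=> Au; have idE : mobius (1%:M : 'M[Cx R]_2) = id.
  by apply: mobius_scalar; rewrite oner_eq0.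
split=> x.
  by rewrite -[LHS]/((mobius _ \o mobius _) x) -mobius_comp// mulVmx// idE.
rewrite -[LHS]/((mobius _ \o mobius _) x) -mobius_comp ?unitmx_inv//.
by rewrite mulmxV// idE.
Qed.

Lemma is_mobius_inj m : is_mobius m -> injective m.
Proof. by case=> A [Au ->]; exact: can_inj (mobius_bij Au).1. Qed.

Lemma is_mobius_comp m1 m2 : is_mobius m1 -> is_mobius m2 ->
  is_mobius (m1 \o m2).
Proof.
move=> [A [Au ->]] [B [Bu ->]]; exists (A *m B).
by rewrite /represented_by unitmx_mul Au Bu mobius_comp.
Qed.

(* A fixed point z satisfies a quadratic equation; three roots force all its
   coefficients to vanish, i.e. A is scalar. *)
Lemma mobius_fix3 A (x y z : Cx R) : A \in unitmx ->
  x != y -> x != z -> y != z ->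
  mobius A (Some x) = Some x -> mobius A (Some y) = Some y ->
  mobius A (Some z) = Some z -> mobius A = id.
Proof.
move=> Au xy xz yz fx fy fz.
pose q (u : Cx R) := A 1 0 * u ^+ 2 + (A 1 1 - A 0 0) * u - A 0 1.
have fixq (u : Cx R) : mobius A (Some u) = Some u -> q u = 0.
  rewrite /=; case: eqVneq => // d0 -[e]; rewrite /q.
  have : A 0 0 * u + A 0 1 = u * (A 1 0 * u + A 1 1) by rewrite -{2}e divfK.
  move=> h; transitivity (u * (A 1 0 * u + A 1 1) - (A 0 0 * u + A 0 1)).
    by ring.
  by rewrite h subrr.
have {fx} qx := fixq _ fx; have {fy} qy := fixq _ fy.
have {fz} qz := fixq _ fz.
(* Divide [q u - q v] by [u - v]; the difference of two such relations then isolates [A 1 0]. *)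
have slope (u v : Cx R) : q u = 0 -> q v = 0 -> u != v ->
    A 1 0 * (u + v) + (A 1 1 - A 0 0) = 0.
  move=> qu qv uv; have : (u - v) * (A 1 0 * (u + v) + (A 1 1 - A 0 0)) = 0.
    by transitivity (q u - q v); [rewrite /q; ring|rewrite qu qv subrr].
  by move/eqP; rewrite mulf_eq0 subr_eq0 (negPf uv) => /eqP.
have sxy := slope _ _ qx qy xy; have sxz := slope _ _ qx qz xz.
have A10 : A 1 0 = 0.
  have : (y - z) * A 1 0 = 0.
    transitivity ((A 1 0 * (x + y) + (A 1 1 - A 0 0))
      - (A 1 0 * (x + z) + (A 1 1 - A 0 0))); first by ring.
    by rewrite sxy sxz subrr.
  by move/eqP; rewrite mulf_eq0 subr_eq0 (negPf yz) => /eqP.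
have A11 : A 1 1 = A 0 0.
  by apply/eqP; rewrite -subr_eq0 -sxy A10 mul0r add0r.
have A01 : A 0 1 = 0.
  by apply/eqP; rewrite -oppr_eq0 -qx /q A10 A11 subrr !mul0r !add0r.
have AE : A = (A 0 0)%:M.
  by apply: mx22P; rewrite !mxE ?mulr0n ?mulr1n.
rewrite AE; apply: mobius_scalar; apply: contraTneq Au => A00.
by rewrite unitmxE det_mx2 A10 A00 mul0r mulr0 subrr unitr0.
Qed.

(** The quotient [invmx B *m A] of the two matrices fixes the three points, so [mobius_fix3] applies
    to it. *)
Lemma is_mobius_eq3 m1 m2 (x y z : Cx R) : is_mobius m1 -> is_mobius m2 ->
  x != y -> x != z -> y != z ->
  m1 (Some x) = m2 (Some x) -> m1 (Some y) = m2 (Some y) ->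
  m1 (Some z) = m2 (Some z) -> m1 = m2.
Proof.
move=> [A [Au ->]] [B [Bu ->]] xy xz yz ex ey ez.
have [BK KB] := mobius_bij Bu.
have CE : mobius (invmx B *m A) = mobius (invmx B) \o mobius A.
  exact: mobius_comp.
have Cid : mobius (invmx B *m A) = id.
  apply: (@mobius_fix3 _ x y z) => //; first by rewrite unitmx_mul unitmx_inv Bu.
  - by rewrite CE /comp ex BK.
  - by rewrite CE /comp ey BK.
  - by rewrite CE /comp ez BK.
apply/funext => p; rewrite -[LHS]KB; congr (mobius B _).
by rewrite -[LHS]/((mobius _ \o mobius _) p) -CE Cid.
Qed.

End Mobius.

(** * Tangency points and rigidity of the base triples *)

Section Triples.
Variable R : realType.
Implicit Types (m : sphere R -> sphere R) (C D : circle R).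

(** Images under an injective map commute with intersections. *)
Lemma maps_circle_tangency m C D C' D' x : injective m ->
  maps_circle m C C' -> maps_circle m D D' ->
  (points C `&` points D = [set x])%classic ->
  (points C' `&` points D' = [set m x])%classic.
Proof.
move=> mI [mC _] [mD _] CD; rewrite -mC -mD.
apply/seteqP; split => [_ [/= [p Cp <-] [q Dq /mI qp]]|_ /= ->].
  rewrite qp in Dq.
  by have : (points C `&` points D)%classic p by []; rewrite CD => ->.
have [Cx Dx] : (points C `&` points D)%classic x by rewrite CD.
by split; exists x.
Qed.

Lemma maps_circle_comp m1 m2 C1 C2 C3 :
  maps_circle m2 C1 C2 -> maps_circle m1 C2 C3 -> maps_circle (m1 \o m2) C1 C3.
Proof. by move=> [p d] [p' d']; split; rewrite -image_comp ?p ?d. Qed.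

Lemma maps_triple_comp m1 m2 (T1 T2 T3 : triple R) :
  maps_triple m2 T1 T2 -> maps_triple m1 T2 T3 -> maps_triple (m1 \o m2) T1 T3.
Proof.
move=> [M2 v w a] [M1 v' w' a']; split; first exact: is_mobius_comp.
- exact: maps_circle_comp v v'.
- exact: maps_circle_comp w w'.
- exact: maps_circle_comp a a'.
Qed.

(* By the parallelogram law, a common point z of the two circles satisfies
   |2z - p - q|^2 = 2|z - p|^2 + 2|z - q|^2 - |p - q|^2 = 0. *)
Lemma base_circle_tangency (p q : Cx R) :
  `|p - q| = (2 * Num.sqrt 3)%:C ->
  (points (base_circle p) `&` points (base_circle q) =
   [set Some ((p + q) / 2)])%classic.
Proof.
move=> pq; have par (u v : R[i]) :
    `|u + v| ^+ 2 + `|u - v| ^+ 2 = 2 * `|u| ^+ 2 + 2 * `|v| ^+ 2 :> R[i].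
  by rewrite !sqr_normc !rmorphD !rmorphN /=; ring.
have n2 : (2 : Cx R) != 0 by rewrite pnatr_eq0.
have half (u : R[i]) : `|u| = (2 * Num.sqrt 3)%:C :> R[i] ->
    `|u / 2| = (Num.sqrt 3)%:C :> R[i].
  move=> e; rewrite normrM normfV normr_nat e rmorphM rmorph_nat.
  by rewrite mulrAC divff// mul1r.
apply/seteqP; split=> [_ [/= [z zp <-] [w zq [wz]]]|_ /= ->].
  rewrite wz in zq.
  have e : `|(z - p) + (z - q)| ^+ 2 = 0 :> R[i].
    apply: (addIr (`|(z - p) - (z - q)| ^+ 2)); rewrite par.
    have -> : (z - p) - (z - q) = - (p - q) by ring.
    have -> : `|- (p - q)| = (2 * Num.sqrt 3)%:C :> R[i] by rewrite normrN.
    have -> : `|z - p| = (Num.sqrt 3)%:C :> R[i] by [].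
    have -> : `|z - q| = (Num.sqrt 3)%:C :> R[i] by [].
    by rewrite rmorphM rmorph_nat; ring.
  congr Some; apply: (mulIf n2); rewrite divfK//.
  apply/eqP; rewrite -subr_eq0; move/eqP: e; rewrite sqrf_eq0 normr_eq0.
  by move/eqP => e; apply/eqP; rewrite -[RHS]e; ring.
have hpq := half _ pq.
(* Conversely, the midpoint is at distance [sqrt 3], half of [|p - q|], from both centres. *)
split; exists ((p + q) / 2) => //=.
  have -> : (p + q) / 2 - p = - ((p - q) / 2) by field.
  by rewrite normrN.
by have -> : (p + q) / 2 - q = (p - q) / 2 by field.
Qed.

(** The tangency points are the midpoints of the centres, distinct because the centres are. Both
    maps must send each of them to the only common point of the two image circles. *)
Lemma maps_base_triple_unique (p q r : Cx R) (T : triple R) m1 m2 :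
  `|p - q| = (2 * Num.sqrt 3)%:C -> `|p - r| = (2 * Num.sqrt 3)%:C ->
  `|q - r| = (2 * Num.sqrt 3)%:C ->
  maps_triple m1 (base_circle p, base_circle q, base_circle r) T ->
  maps_triple m2 (base_circle p, base_circle q, base_circle r) T ->
  m1 = m2.
Proof.
move=> pq pr qr [M1 p1 q1 r1] [M2 p2 q2 r2].
have neq (u v : Cx R) : `|u - v| = (2 * Num.sqrt 3)%:C -> u != v.
  rewrite -subr_eq0 -normr_eq0 => ->; rewrite fmorph_eq0.
  by rewrite mulf_neq0 ?pnatr_eq0// gt_eqF ?sqrt3_gt0.
have n2 : (2 : Cx R)^-1 != 0 by rewrite invr_eq0 pnatr_eq0.
have agree (u v : Cx R) C D : `|u - v| = (2 * Num.sqrt 3)%:C ->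
    maps_circle m1 (base_circle u) C -> maps_circle m2 (base_circle u) C ->
    maps_circle m1 (base_circle v) D -> maps_circle m2 (base_circle v) D ->
    m1 (Some ((u + v) / 2)) = m2 (Some ((u + v) / 2)).
  move=> /base_circle_tangency uv C1 C2 D1 D2.
  have e1 := maps_circle_tangency (is_mobius_inj M1) C1 D1 uv.
  have e2 := maps_circle_tangency (is_mobius_inj M2) C2 D2 uv.
  have : [set m1 (Some ((u + v) / 2))]%classic (m1 (Some ((u + v) / 2))) by [].
  by rewrite -e1 e2.
apply: (@is_mobius_eq3 _ _ _ ((p + q) / 2) ((p + r) / 2) ((q + r) / 2)) => //.
- by rewrite (inj_eq (mulIf n2)) (inj_eq (addrI _)) neq.
- by rewrite (inj_eq (mulIf n2)) [p + q]addrC (inj_eq (addrI _)) neq.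
- by rewrite (inj_eq (mulIf n2)) (inj_eq (addIr _)) neq.
- exact: agree p1 p2 q1 q2.
- exact: agree p1 p2 r1 r2.
- exact: agree q1 q2 r1 r2.
Qed.

Lemma base_vw_dist :
  `|(1 -i* Num.sqrt 3 : R[i]) - (1 +i* Num.sqrt 3 : R[i])|
    = (2 * Num.sqrt 3)%:C :> R[i].
Proof.
rewrite normc_def /=; congr (_%:C).
rewrite subrr expr0n /= add0r -opprD sqrrN sqrtr_sqr.
by rewrite -mulr2n mulr_natl ger0_norm// mulrn_wge0 // sqrtr_ge0.
Qed.

(** The centres [-2] and [4] are both at horizontal distance 3 from 1, so the one identity
    [9 + 3 = (2 sqrt 3)^2] serves all four remaining tangencies. *)
Lemma base_dist (x y : R) : (x - 1) ^+ 2 = 9 -> y ^+ 2 = 3 ->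
  `|(1 +i* y : R[i]) - x%:C| = (2 * Num.sqrt 3)%:C :> R[i].
Proof.
move=> hx hy; rewrite normc_def /=; congr (_%:C).
rewrite subr0 hy -sqrrN opprB hx.
have -> : 9 + 3 = (2 * Num.sqrt 3) ^+ 2 :> R.
  by rewrite exprMn sqr_sqrtr ?ler0n//; ring.
by rewrite sqrtr_sqr ger0_norm// mulr_ge0 // sqrtr_ge0.
Qed.

Lemma maps_base_f_unique (T : triple R) m1 m2 :
  maps_triple m1 (base_f R) T -> maps_triple m2 (base_f R) T -> m1 = m2.
Proof.
have e : (- 2 : Cx R) = (- 2 : R)%:C by rewrite rmorphN rmorph_nat.
apply: maps_base_triple_unique; rewrite ?e; first exact: base_vw_dist.
  by apply: base_dist; [ring|rewrite sqrrN sqr_sqrtr ?ler0n].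
by apply: base_dist; [ring|rewrite sqr_sqrtr ?ler0n].
Qed.

Lemma maps_base_g_unique (T : triple R) m1 m2 :
  maps_triple m1 (base_g R) T -> maps_triple m2 (base_g R) T -> m1 = m2.
Proof.
have e : (4 : Cx R) = (4 : R)%:C by rewrite rmorph_nat.
apply: maps_base_triple_unique; rewrite ?e; first exact: base_vw_dist.
  by apply: base_dist; [ring|rewrite sqrrN sqr_sqrtr ?ler0n].
by apply: base_dist; [ring|rewrite sqr_sqrtr ?ler0n].
Qed.

Lemma base_vw_tangency :
  (points (base_v R) `&` points (base_w R) = [set Some (1 : Cx R)])%classic.
Proof.
rewrite base_circle_tangency; last exact: base_vw_dist.
congr [set Some _]%classic.
have -> : (1 -i* Num.sqrt 3 : R[i]) + (1 +i* Num.sqrt 3 : R[i]) = 2.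
  by apply/eqP; rewrite eq_complex /= addNr ?addr0 !eqxx.
by rewrite divff// pnatr_eq0.
Qed.

End Triples.

(** Composing with [mg] on the left trades the inverse for an equation usable by rewriting. *)
Lemma quotient_representedE (R : realType) (mg mf : sphere R -> sphere R)
    (A : 'M[Cx R]_2) :
  quotient_represented_by mg mf A -> A \in unitmx /\ mf = mg \o mobius A.
Proof.
move=> [mg' [K K' [Au e]]]; split=> //.
by rewrite -e; apply/funext => x /=; rewrite K'.
Qed.

(** * Parabolic matrices: addition of parameters and conjugation *)

Section Parabolic.
Variable R : realType.

(* The normal form defining the intrinsic schwarzian, with s allowed complex. *)
Definition parabolic1 (s : Cx R) : 'M[Cx R]_2 := mx22 (1 + s) (- s) s (1 - s).

Lemma parabolic1_unit (s : Cx R) : parabolic1 s \in unitmx.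
Proof.
rewrite unitmxE det_mx2 !mxE /=.
have -> : (1 + s) * (1 - s) - - s * s = 1 by ring.
exact: unitr1.
Qed.

(** [parabolic1 s] is [1 + s N] with [N ^ 2 = 0], so the cross term vanishes. *)
Lemma parabolic1M (s u : Cx R) :
  parabolic1 s *m parabolic1 u = parabolic1 (s + u).
Proof. by apply: mx22P; rewrite mulmx2E !mxE /=; ring. Qed.

(* Compare the images of infinity, which are 1 + 1/s. *)
Lemma mobius_parabolic1_inj (s u : Cx R) :
  mobius (parabolic1 s) = mobius (parabolic1 u) -> s = u.
Proof.
move=> /(congr1 (@^~ None)) /=; rewrite !mxE /=.
case: (eqVneq s 0) => [->|s0]; case: (eqVneq u 0) => [->|u0] //.
by move=> [] /eqP; rewrite !mulrDl !divff// !(inj_eq (addIr _)) !mul1r;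
  move=> /eqP/invr_inj.
Qed.

(** Both nilpotent parts have rank one: column [(t, 1)] times row [(1, -t)], and column [(1, 1)]
    times row [(1, -1)]. The matrix [mx22 a b c d] sends the column [(1, 1)] to [(c + d)(t, 1)], and
    the row [(1, -t)] times it is [(1, -1) / (c + d)]; hence the factor [(c + d)^-2]. *)
Lemma parabolic_conj (a b c d sigma : Cx R) :
  a * d - b * c = 1 -> c + d != 0 ->
  let t := (a + b) / (c + d) in
  (1%:M + sigma *: mx22 t (- t ^+ 2) 1 (- t)) *m mx22 a b c d =
  mx22 a b c d *m parabolic1 (sigma / (c + d) ^+ 2).
Proof.
move=> det1 cd /=.
have ht : (a + b) / (c + d) * (c + d) = a + b by rewrite divfK.
move: ((a + b) / (c + d)) ht => t ht.
(* The two entries of the row [(1, -t)] times the matrix; they serve to eliminate [a] and [b] before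
   [field]. *)
have hl : a - t * c = (c + d)^-1.
  apply: (mulIf cd); rewrite mulVf// -det1 -[RHS]addr0.
  by rewrite mulrBl mulrAC ht; ring.
have hr : b - t * d = - (c + d)^-1.
  apply: (mulIf cd); rewrite mulNr mulVf// -det1.
  by rewrite mulrBl mulrAC ht; ring.
have -> : a = t * c + (c + d)^-1 by rewrite -hl; ring.
have -> : b = t * d - (c + d)^-1 by rewrite -hr; ring.
by apply: mx22P; rewrite !mulmx2E !mxE /= ?mulr0n ?mulr1n; field.
Qed.

End Parabolic.

Lemma derive1_homography (K : numFieldType) (a b c d x : K) :
  a * d - b * c = 1 -> c * x + d != 0 ->
  derive1 (fun z : K => (a * z + b) / (c * z + d)) x = ((c * x + d) ^+ 2)^-1.
Proof.
move=> det1 cd.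
have lin (u v : K) : is_derive x 1 (fun z : K => u * z + v) u.
  have := is_deriveD (is_deriveZ u (is_derive_id x (1 : K))) (is_derive_cst v x 1).
  by rewrite addr0 /GRing.scale /= mulr1.
have linV : is_derive x 1 (fun z : K => (c * z + d)^-1)
    (- (c * x + d) ^- 2 *: c).
  have := lin c d; move=> [dl el]; split; first exact: derivableV.
  by rewrite deriveV // el.
rewrite derive1E.
(* Seen as a product of two functions, the quotient falls under [is_deriveM]. *)
have -> : (fun z : K => (a * z + b) / (c * z + d)) =
    (fun z : K => a * z + b) * (fun z : K => (c * z + d)^-1) by [].
rewrite (@derive_val _ _ _ _ _ _ _ (is_deriveM (lin a b) linV)).
rewrite /GRing.scale /=.
transitivity ((a * d - b * c) / (c * x + d) ^+ 2); first by field.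
by rewrite det1 mul1r.
Qed.

(** * Comparison of the two intrinsic schwarzians *)

Theorem mainTheorem7 (R : realType) (K : surface_complex)
    (F : discrete_analytic R K) (e : edge_patch K)
    (finite_tangency : exists t : Cx R,
       tangent_at (source F (pv e)) (source F (pw e)) (Some t))
    (s s' : R) (sigma : Cx R)
    (hs : is_intrinsic_schwarzian (source F) e s)
    (hs' : is_intrinsic_schwarzian (target F) e s')
    (hsigma : is_discrete_schwarzian F e sigma)
    (a b c d : Cx R) (det1 : a * d - b * c = 1)
    (hm : maps_triple (mobius (mx22 a b c d)) (base_f R)
            (triple_f (source F) e)) :
  (s'%:C : Cx R) =
    s%:C + sigma * derive1 (fun z : Cx R => (a * z + b) / (c * z + d)) 1 /\
  s%:C + sigma * derive1 (fun z : Cx R => (a * z + b) / (c * z + d)) 1 =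
    s%:C + sigma / (c + d) ^+ 2 :> Cx R.
Proof.
case: hs => muf [mug [Hmuf Hmug /quotient_representedE[_ mufE]]].
case: hs' => muf' [mug' [Hmuf' Hmug' /quotient_representedE[_ mufE']]].
case: hsigma => t [mf [mg [Ht Hmf Hmg /quotient_representedE[_ mfE]]]].
have Mu : mx22 a b c d \in unitmx.
  by rewrite unitmxE det_mx2 !mxE /= det1 unitr1.
have [_ bv bw _] := hm.
have Mmob : is_mobius (mobius (mx22 a b c d)) by exists (mx22 a b c d).
(* The base circles meet only at 1 and their images only at [t]. *)
have M1 : mobius (mx22 a b c d) (Some 1) = Some t.
  have Mt := maps_circle_tangency (is_mobius_inj Mmob) bv bw (base_vw_tangency R).
  have : [set mobius (mx22 a b c d) (Some (1 : Cx R))]%classic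
    (mobius (mx22 a b c d) (Some (1 : Cx R))) by [].
  by rewrite -Mt Ht.1.
(* Finiteness of [t] excludes the pole branch of [mobius] at 1. *)
have [cd tE] : c + d != 0 /\ t = (a + b) / (c + d).
  by move: M1; rewrite /= !mxE /= !mulr1; case: eqVneq => // cd [<-].
have hderiv := @derive1_homography (Cx R) a b c d 1 det1.
rewrite mulr1 in hderiv; rewrite hderiv// {hderiv}; split=> //.
have mufM := maps_base_f_unique Hmuf hm.
have muf'M : muf' = mf \o muf.
  exact: maps_base_f_unique Hmuf' (maps_triple_comp Hmuf Hmf).
have mug'M : mug' = mg \o mug.
  exact: maps_base_g_unique Hmug' (maps_triple_comp Hmug Hmg).
have [/is_mobius_inj mgI _ _ _] := Hmg; have [/is_mobius_inj mugI _ _ _] := Hmug.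
(* The parameters agree if the parabolic maps do, and these may be compared after applying the
   injective [mg \o mug], which turns the left side into [muf']. *)
apply: mobius_parabolic1_inj; apply/funext => p; apply/mugI/mgI.
rewrite -parabolic1M mobius_comp ?parabolic1_unit//.
transitivity (muf' p); first by rewrite mufE' mug'M.
rewrite muf'M /= mfE mufM /=; congr (mg _).
rewrite -[LHS]/((mobius _ \o mobius _) p) -mobius_comp// tE.
rewrite parabolic_conj// mobius_comp ?parabolic1_unit//=.
by rewrite -mufM mufE.
Qed.
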